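(* Let $d\ge2$ and $n\ge2$ be integers and let $W=W(D_{n,d};q)$. Then the coefficient sequence $([q^i]W)_{i\ge0}$ is unimodal. Moreover, if $k\ge0$ and $n_k\le n<p_k$, then $[q^{2k}]W$ or $[q^{2k+1}]W$ is a maximum coefficient; if $p_k\le n<n_{k+1}$, then $[q^{2k+2}]W$ is a maximum coefficient and the coefficient sequence is weakly increasing (up to degree $2k+2$).
   Context: For a connected graph $G$, $W(G;q)=\sum_{\{u,v\}}q^{d(u,v)}$ over unordered pairs of distinct vertices, $d$ the graph distance; $[q^i]f$ is the coefficient of $q^i$ in $f$. A sequence $(a_m)_{m\ge0}$ is unimodal if for some index $j$, $a_0\le a_1\le\cdots\le a_j\ge a_{j+1}\ge a_{j+2}\ge\cdots$. The $d$-ary dendrimer $D_{n,d}$ is the tree on vertex set $\{1,\ldots,n\}$ defined inductively: $D_{1,d}$ is the single vertex $1$, and $D_{n,d}$ is obtained from $D_{n-1,d}$ by attaching a new leaf $n$ to the smallest-numbered vertex of $D_{n-1,d}$ having degree $\le d$. Define $n_k=2+(d+1)\frac{d^k-1}{d-1}$, $m_k=3+2d\frac{d^k-1}{d-1}$ and $p_k=m_k+2d^k-1$ for $k\ge0$. *)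

(* Defs.v *)
From mathcomp Require Import all_boot.
Set Implicit Arguments. Unset Strict Implicit. Unset Printing Implicit Defensive.

(* Graphs on vertex set {1,...,n} given by an edge list. *)
Definition deg (E : seq (nat * nat)) (v : nat) : nat :=
  count (fun e => (e.1 == v) || (e.2 == v)) E.

Definition adj (E : seq (nat * nat)) (u v : nat) : bool :=
  ((u, v) \in E) || ((v, u) \in E).

Fixpoint dend_edges (d n : nat) : seq (nat * nat) :=
  match n with
  | 0 => [::]
  | n'.+1 =>
      if n' == 0 then [::] else
      let E := dend_edges d n' in
      let par := nth 0 (iota 1 n') (find (fun v => deg E v <= d) (iota 1 n')) in
      rcons E (par, n'.+1)
  end.

Fixpoint walk (E : seq (nat * nat)) (n k u v : nat) : bool :=
  match k with
  | 0 => u == v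
  | k'.+1 => has (fun w => adj E u w && walk E n k' w v) (iota 1 n)
  end.

(* Graph distance in D_{n,d}: least k with a walk of length k from u to v.
   Since D_{n,d} is connected on n vertices, this least k is < n, so the
   search over 0..n-1 is exhaustive. *)
Definition dend_dist (d n u v : nat) : nat :=
  find (fun k => walk (dend_edges d n) n k u v) (iota 0 n).

Definition wcoef (d n i : nat) : nat :=
  \sum_(1 <= u < n.+1) \sum_(u.+1 <= v < n.+1) (dend_dist d n u v == i).

Definition unimodal (a : nat -> nat) : Prop :=
  exists j, (forall m, m < j -> a m <= a m.+1) /\ (forall m, j <= m -> a m.+1 <= a m).

Definition is_max_coef (a : nat -> nat) (i : nat) : Prop := forall m, a m <= a i.

Definition n_k (d k : nat) : nat := 2 + (d.+1) * ((d ^ k - 1) %/ (d - 1)).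
Definition m_k (d k : nat) : nat := 3 + 2 * d * ((d ^ k - 1) %/ (d - 1)).
Definition p_k (d k : nat) : nat := m_k d k + 2 * d ^ k - 1.

(* Main.v *)
(** Attaching the leaf [m] adds to the coefficient of [q^i] the number [c_i(m)]
    of earlier vertices at distance [i] from [m].  The parent of [m] is
    [(m - 3) %/ d + 1], and counting neighbours of vertices preceding it yields
    [c_{i+2}(m) = d * c_i(parent m)] for [i >= 1].  Summing over [m], the
    coefficient of [q^{i+2}] at [n = d * w + 2 + y], with [y <= d], is
    [d * ((d - y) * A_i(w) + y * A_i(w + 1))], where [A_i] is the coefficient of
    [q^i]: an interpolation along the affine map [w |-> d * w + 2].  Hence every
    comparison between consecutive coefficients valid for [n >= a] (or [n <= a])
    lifts to one in degree two higher valid for [n >= d * a + 2] (or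
    [n <= d * a + 2]).  Both [p_k] and [n_k - 1] are orbits of this map, starting
    at [4] and [1], so only the coefficients of [q], [q^2] and [q^3] have to be
    compared by hand. *)

Require Import Defs.
From mathcomp Require Import all_boot zify.

Set Implicit Arguments.
Unset Strict Implicit.

(* The truncated subtraction makes [parent d 2 = 1]. *)
Definition parent (d m : nat) : nat := ((m - 3) %/ d).+1.

(** * Arithmetic of the parent map *)

Lemma parent_block (d w y : nat) :
  0 < y <= d -> parent d (d * w + 2 + y) = w.+1.
Proof.
move=> /andP[y0 yd]; rewrite /parent; congr S.
have -> : d * w + 2 + y - 3 = w * d + y.-1 by lia.
by rewrite divnMDl ?divn_small ?addn0 //; lia.
Qed.

Lemma parent2 (d : nat) : parent d 2 = 1.
Proof. by rewrite /parent div0n. Qed.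

Lemma block_decomp (d m : nat) :
  0 < d -> 2 < m -> exists w y, [/\ m = d * w + 2 + y, 0 < y & y <= d].
Proof.
move=> d0 m2; exists ((m - 3) %/ d), ((m - 3) %% d).+1.
have := divn_eq (m - 3) d; have := ltn_pmod (m - 3) d0; split=> //; lia.
Qed.

Lemma parent_lt (d m : nat) : 0 < d -> 1 < m -> parent d m < m.
Proof.
move=> d0 m1; rewrite /parent; have := leq_div (m - 3) d; lia.
Qed.

Lemma parent_gt0 (d m : nat) : 0 < parent d m.
Proof. by []. Qed.

(** Group the vertices by parent: vertex [1] has the extra child [2], each of [1, ..., w] has a full
    block of [d] children, and [w.+1] has [y] so far. *)
Lemma sum_parent (d : nat) (f : nat -> nat) (w y : nat) : y <= d ->
  \sum_(2 <= u < (d * w + 2 + y).+1) f (parent d u) =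
  f 1 + d * (\sum_(1 <= v < w.+1) f v) + y * f w.+1.
Proof.
elim: w y => [|w IHw] y; elim: y => [|y IHy] yd.
- by rewrite muln0 big_nat1 parent2 big_geq // muln0 !addn0.
- rewrite addnS big_nat_recr /=; last by lia.
  by rewrite IHy ?(ltnW yd) // -addnS parent_block ?yd //; lia.
- have -> : d * w.+1 + 2 + 0 = d * w + 2 + d by lia.
  by rewrite IHw // [in RHS]big_nat_recr //=; lia.
- rewrite addnS big_nat_recr /=; last by lia.
  by rewrite IHy ?(ltnW yd) // -addnS parent_block ?yd //; lia.
Qed.

(** * Edges and degrees of the dendrimer *)

Lemma dend_edgesS (d n : nat) : 0 < n ->
  dend_edges d n.+1 = rcons (dend_edges d n)
    (nth 0 (iota 1 n) (find (fun v => deg (dend_edges d n) v <= d) (iota 1 n)),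
     n.+1).
Proof. by case: n. Qed.

Lemma deg_rcons (E : seq (nat * nat)) (e : nat * nat) (v : nat) :
  deg (rcons E e) v = deg E v + ((e.1 == v) || (e.2 == v)).
Proof. by rewrite /deg -cats1 count_cat /= addn0. Qed.

Lemma find_iota1 (P : pred nat) (n v : nat) : 0 < v <= n ->
  P v -> (forall u, 0 < u < v -> ~~ P u) ->
  nth 0 (iota 1 n) (find P (iota 1 n)) = v.
Proof.
move=> /andP[v0 vn] Pv nP.
have vin : v \in iota 1 n by rewrite mem_iota; lia.
have hasP : has P (iota 1 n) by apply/hasP; exists v.
have fn : find P (iota 1 n) < n by rewrite -{2}(size_iota 1 n) -has_find.
have Pf := nth_find 0 hasP.
rewrite nth_iota // in Pf *.
case: (ltngtP (1 + find P (iota 1 n)) v) => // [lt|gt].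
  by have := nP _ (_ : 0 < 1 + find P (iota 1 n) < v); rewrite Pf lt => /(_ isT).
have := @before_find _ 0 P (iota 1 n) v.-1.
by rewrite nth_iota ?add1n ?prednK ?Pv; try lia; move=> H; have := H ltac:(lia).
Qed.

(** One induction serves both claims, since the chosen parent depends on the current degrees. The
    boolean is the edge to the parent (to vertex [2] when [v = 1]); the minimum counts the children
    in the block of [v]. *)
Lemma deg_dend_edges (d n : nat) : 1 < d -> 1 < n ->
  dend_edges d n = rcons (dend_edges d n.-1) (parent d n, n) /\
  forall v, 0 < v ->
    deg (dend_edges d n) v = (v <= n) + minn (n - (d * v.-1 + 2)) d.
Proof.
move=> d1; elim: n => // n IHn; rewrite ltnS leq_eqVlt => /orP[/eqP <-|n1].
  split; first by rewrite parent2.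
  move=> [|[|[|v]]] // _; rewrite /deg /=; lia.
have [_ degn] := IHn n1.
have [w [y [En y0 yd]]] : exists w y, [/\ n.+1 = d * w + 2 + y, 0 < y & y <= d].
  by apply: block_decomp; lia.
have Ep : parent d n.+1 = w.+1 by rewrite En parent_block // y0.
have wn : w < n by nia.
have Ed : dend_edges d n.+1 = rcons (dend_edges d n) (parent d n.+1, n.+1).
  rewrite dend_edgesS; last by lia.
  (* Vertex [w.+1] has degree [y <= d], while all smaller vertices already have degree [d.+1]. *)
  congr (rcons _ (_, _)); rewrite Ep; apply: find_iota1; first by lia.
    by rewrite degn //=; lia.
  by move=> u /andP[u0 uw]; rewrite degn // -ltnNge; nia.
split=> // v v0; rewrite Ed deg_rcons /= Ep degn //.
case: (ltngtP v w.+1) => [vw|vw|->] /=.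
- have : d * v <= d * w by rewrite leq_mul2l; lia.
  have : d * v = d * v.-1 + d by rewrite -[in LHS](prednK v0) mulnS addnC.
  lia.
- have : d * w.+1 <= d * v.-1 by rewrite leq_mul2l; lia.
  rewrite mulnS; lia.
- lia.
Qed.

Lemma adj_dend (d n u v : nat) : 1 < d ->
  adj (dend_edges d n) u v =
  [&& 1 < v, v <= n & u == parent d v] || [&& 1 < u, u <= n & v == parent d u].
Proof.
move=> d1; elim: n => [|n IHn].
  by rewrite /adj /=; move: u v => [|u] [|v]; rewrite ?andbF.
case: (posnP n) => [->|n0].
  by rewrite /adj /=; move: u v {IHn} => [|[|u]] [|[|v]]; rewrite ?andbF.
have [-> _] := @deg_dend_edges d n.+1 d1 n0.
rewrite /adj /= !mem_rcons !inE !xpair_eqE.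
move: IHn; rewrite /adj; move: (_ \in _) (_ \in _) => a b.
case: (eqVneq v n.+1) => [->|vn]; case: (eqVneq u n.+1) => [->|un];
  rewrite ?andbT ?andbF ?orbF /=; lia.
Qed.

(** * Tree distance *)

(** Parents have smaller labels, so the path between two vertices leaves the larger one through its
    parent, and [u + v] is enough fuel for positive labels. *)
Fixpoint tdist_fuel (d k u v : nat) : nat :=
  if k is k'.+1 then
    if u == v then 0
    else if u < v then (tdist_fuel d k' u (parent d v)).+1
    else (tdist_fuel d k' (parent d u) v).+1
  else 0.

Definition tdist (d u v : nat) : nat := tdist_fuel d (u + v) u v.

Lemma tdist_fuelE (d k u v : nat) : 1 < d -> 0 < u -> 0 < v -> u + v <= k ->
  tdist_fuel d k u v = tdist d u v.
Proof.
move=> d1; have [N] := ubnP (u + v); elim: N k u v => // N IH k u v uvN u0 v0.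
have P m : 1 < m -> parent d m < m by apply: parent_lt; lia.
case: k => [|k] uvk; first by lia.
rewrite /tdist; case E: (u + v) => [|k'] /=; first by lia.
case: eqVneq => // uv; case: ltnP => uv'; congr S.
  have := P v ltac:(lia) => Pv.
  by rewrite !IH //; lia.
have := P u ltac:(lia) => Pu.
by rewrite !IH //; lia.
Qed.

Lemma tdistxx (d u : nat) : tdist d u u = 0.
Proof. by rewrite /tdist; case: (u + u) => //= k; rewrite eqxx. Qed.

Lemma tdist_parentr (d u v : nat) : 1 < d -> 0 < u -> u < v ->
  tdist d u v = (tdist d u (parent d v)).+1.
Proof.
move=> d1 u0 uv; have Pv : parent d v < v by apply: parent_lt; lia.
rewrite {1}/tdist; case E: (u + v) => [|k] /=; first by lia.
rewrite uv (_ : (u == v) = false); last by lia.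
by rewrite tdist_fuelE //; lia.
Qed.

Lemma tdist_parentl (d u v : nat) : 1 < d -> 0 < v -> v < u ->
  tdist d u v = (tdist d (parent d u) v).+1.
Proof.
move=> d1 u0 uv; have Pv : parent d u < u by apply: parent_lt; lia.
rewrite {1}/tdist; case E: (u + v) => [|k] /=; first by lia.
rewrite ltnNge ltnW //= (_ : (u == v) = false); last by lia.
by rewrite tdist_fuelE //; lia.
Qed.

Lemma tdist_lt (d u v n : nat) : 1 < d -> 0 < u -> 0 < v -> u <= n -> v <= n ->
  tdist d u v < n.
Proof.
move=> d1; elim: n u v => [|n IH] u v u0 v0 un vn; first by lia.
case: (ltngtP u v) => [uv|uv|->]; last by rewrite tdistxx.
  have Pv : parent d v < v by apply: parent_lt; lia.
  by rewrite tdist_parentr // ltnS IH //; lia.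
have Pu : parent d u < u by apply: parent_lt; lia.
by rewrite tdist_parentl // ltnS IH //; lia.
Qed.

(** Crossing an edge changes [tdist] by at most one, which bounds walk lengths from below. If
    [m < v], both distances pass through the parent of [v]. *)
Lemma tdist_parent_lip (d m v : nat) : 1 < d -> 1 < m -> 0 < v ->
  tdist d m v <= (tdist d (parent d m) v).+1 /\
  tdist d (parent d m) v <= (tdist d m v).+1.
Proof.
move=> d1 m1; have Pm : parent d m < m by apply: parent_lt; lia.
have [N] := ubnP v; elim: N v => // N IH v vN v0.
case: (ltngtP m v) => [mv|mv|<-].
- have Pv : parent d v < v by apply: parent_lt; lia.
  have [] := IH (parent d v) ltac:(lia) isT.
  by rewrite (@tdist_parentr d m v) ?(@tdist_parentr d (parent d m) v) //; lia.
- by rewrite (@tdist_parentl d m v) //; lia.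
- by rewrite tdistxx tdist_parentr // tdistxx.
Qed.

(** * Agreement with the graph distance *)

Lemma tdist_adj (d n u w v : nat) : 1 < d -> 0 < v -> adj (dend_edges d n) u w ->
  tdist d u v <= (tdist d w v).+1.
Proof.
move=> d1 v0; rewrite adj_dend // => /orP[] /and3P[m1 _ /eqP->].
  by have [] := @tdist_parent_lip d w v d1 m1 v0.
by have [] := @tdist_parent_lip d u v d1 m1 v0.
Qed.

Lemma walk_tdist_le (d n k u v : nat) : 1 < d -> 0 < v ->
  walk (dend_edges d n) n k u v -> tdist d u v <= k.
Proof.
move=> d1 v0; elim: k u => [|k IH] u /=; first by move/eqP->; rewrite tdistxx.
case/hasP=> w _ /andP[uw /IH wv].
by have := @tdist_adj d n u w v d1 v0 uw; lia.
Qed.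

Lemma walk_rcons (E : seq (nat * nat)) (n k u x v : nat) : 0 < v <= n ->
  walk E n k u x -> adj E x v -> walk E n k.+1 u v.
Proof.
move=> vn; elim: k u => [|k IH] u.
  move=> /eqP-> xv; apply/hasP; exists v; first by rewrite mem_iota; lia.
  by rewrite xv /= eqxx.
case/hasP=> w win /andP[uw wx] xv; apply/hasP; exists w => //.
by apply/andP; split=> //; apply: IH.
Qed.

Lemma walk_tdist (d n u v : nat) : 1 < d -> 0 < u <= n -> 0 < v <= n ->
  walk (dend_edges d n) n (tdist d u v) u v.
Proof.
move=> d1; have [N] := ubnP (u + v); elim: N u v => // N IH u v uvN un vn.
case: (ltngtP u v) => [uv|uv|->]; last by rewrite tdistxx /=.
- have Pv : parent d v < v by apply: parent_lt; lia.
  rewrite tdist_parentr //; last by lia.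
  apply: (@walk_rcons _ _ _ _ (parent d v)); first by lia.
    by apply: IH; have := parent_gt0 d v; lia.
  by rewrite adj_dend // eqxx; lia.
- have Pu : parent d u < u by apply: parent_lt; lia.
  rewrite tdist_parentl //; last by lia.
  have Pu0 := parent_gt0 d u.
  apply/hasP; exists (parent d u); first by rewrite mem_iota; lia.
  by apply/andP; split; [rewrite adj_dend // eqxx | apply: IH]; lia.
Qed.

Lemma dend_distE (d n u v : nat) : 1 < d -> 0 < u <= n -> 0 < v <= n ->
  dend_dist d n u v = tdist d u v.
Proof.
move=> d1 un vn; rewrite /dend_dist; set P := fun k => _.
have tn : tdist d u v < n by apply: tdist_lt; lia.
have Pt : P (tdist d u v) by apply: walk_tdist.
have hP : has P (iota 0 n).
  by apply/hasP; exists (tdist d u v) => //; rewrite mem_iota.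
have fn : find P (iota 0 n) < n by rewrite -{2}(size_iota 0 n) -has_find.
apply/eqP; rewrite eqn_leq; apply/andP; split.
  rewrite leqNgt; apply/negP => /(before_find 0).
  by rewrite nth_iota ?add0n ?Pt.
have := nth_find 0 hP; rewrite nth_iota // add0n.
by apply: walk_tdist_le; lia.
Qed.

(** * Earlier vertices at a given distance *)

Definition ncount (d i m : nat) : nat := \sum_(1 <= u < m) (tdist d u m == i).

Lemma wcoefE (d n i : nat) : 1 < d ->
  wcoef d n i = \sum_(1 <= m < n.+1) ncount d i m.
Proof.
move=> d1; rewrite /wcoef /ncount.
transitivity (\sum_(1 <= u < n.+1) \sum_(1 <= v < n.+1 | u < v)
    (tdist d u v == i)).
  apply: eq_big_nat => u un; rewrite (@big_nat_widenl _ _ _ u.+1 1) //=.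
  rewrite big_nat_cond [RHS]big_nat_cond; apply: eq_bigr => v /andP[vn _].
  by rewrite dend_distE //; lia.
rewrite (exchange_big_dep_nat xpredT) //=.
by apply: eq_big_nat => v vn; rewrite (@big_nat_widen _ _ _ _ v n.+1) //; lia.
Qed.

Lemma tdist_eq0 (d u v : nat) : 1 < d -> 0 < u -> 0 < v ->
  (tdist d u v == 0) = (u == v).
Proof.
move=> d1 u0 v0; case: (ltngtP u v) => [uv|uv|->]; last by rewrite tdistxx.
  by rewrite tdist_parentr.
by rewrite tdist_parentl.
Qed.

Lemma sum_nat_eq (a m n : nat) :
  \sum_(m <= u < n) (u == a) = (m <= a < n) :> nat.
Proof.
have := big_nat1_eq addn (fun=> 1) a m n; rewrite big_mkcond /=.
by under eq_bigr => u _ do rewrite -[if _ then _ else _]/(nat_of_bool _);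
  case: (_ && _).
Qed.

Lemma ncount1 (d i : nat) : ncount d i 1 = 0.
Proof. by rewrite /ncount big_geq. Qed.

Lemma ncount_adj (d m : nat) : 1 < d -> 1 < m -> ncount d 1 m = 1.
Proof.
move=> d1 m1; have Pm : parent d m < m by apply: parent_lt; lia.
transitivity (\sum_(1 <= u < m) (u == parent d m)).
  2: by rewrite sum_nat_eq Pm.
by apply: eq_big_nat => u um; rewrite tdist_parentr ?eqSS ?tdist_eq0 //; lia.
Qed.

(** Step from [m] to its parent [p]; an earlier vertex beyond [p] then also steps to its own
    parent. *)
Lemma ncount_split (d t m : nat) : 1 < d -> 1 < m ->
  ncount d t.+2 m = ncount d t.+1 (parent d m) +
    \sum_((parent d m).+1 <= u < m) (tdist d (parent d u) (parent d m) == t).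
Proof.
move=> d1 m1; have Pm : parent d m < m by apply: parent_lt; lia.
rewrite {1}/ncount.
under eq_big_nat => u /andP[u0 um] do rewrite tdist_parentr // eqSS.
rewrite (@big_cat_nat _ _ _ (parent d m)) //=; last exact: ltnW.
rewrite [X in _ + X]big_ltn // tdistxx /= add0n; congr (_ + _).
by apply: eq_big_nat => u um; rewrite tdist_parentl ?eqSS //; lia.
Qed.

(* Off the path from the root to [w], the parent of [u] is one step closer to
   [w] than [u]; along that path the distances shift the other way, and the
   mismatch is exactly the root term. *)
Lemma ncount_parents (d s w : nat) : 1 < d -> 0 < w ->
  ncount d s.+2 w + (tdist d 1 w == s.+1) =
  \sum_(2 <= u < w.+1) (tdist d (parent d u) w == s.+1).
Proof.
move=> d1; elim: s w => [|s IH] w w0.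
all: case: (ltngtP 1 w) => [w1||<-]; [|by lia|by rewrite ncount1 tdistxx big_geq].
all: have Pw : parent d w < w by apply: parent_lt; lia.
all: rewrite ncount_split // tdist_parentr // eqSS.
all: have Pu u : 2 <= u < w.+1 -> parent d u < w
  by move=> uw; have := @parent_lt d u; lia.
all: under [RHS]eq_big_nat => u uw do
  rewrite (tdist_parentr d1 (parent_gt0 d u) (Pu u uw)) eqSS.
all: rewrite [RHS]big_nat_recr //= tdistxx.
all: rewrite [in RHS](@big_cat_nat _ _ _ (parent d w).+1) //=.
(* The term [u = w] is [1]; it matches the root term if [parent d w = 1], and otherwise the parent
   of [parent d w]. *)
- rewrite [in RHS]big1_seq; last first.
    move=> u; rewrite mem_index_iota => /andP[_ uw].
    by rewrite tdist_eq0 //; have := @parent_lt d u; lia.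
  rewrite tdist_eq0 //.
  have [->|P1] : parent d w = 1 \/ 1 < parent d w.
    by have := parent_gt0 d w; lia.
    by rewrite ncount1 eqxx; lia.
  by rewrite ncount_adj //; lia.
(* The term [u = w] is now zero, and the terms up to [parent d w] form the identity for that
   parent. *)
- by rewrite -IH //; lia.
Qed.

(** Once the root term is added to both sides, every vertex from [2] to [m - 1] is counted by the
    distance from its parent to [p = parent d m]. Vertices before [p] count [d] times each, [p]
    contributes zero, and the extra child [2] gives the root term. *)
Lemma ncount_parent (d s m : nat) : 1 < d -> 1 < m ->
  ncount d s.+3 m = d * ncount d s.+1 (parent d m).
Proof.
move=> d1 m1; have Pm : parent d m < m by apply: parent_lt; lia.
apply/eqP; rewrite -(eqn_add2r (tdist d 1 (parent d m) == s.+1)).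
rewrite ncount_split // addnAC ncount_parents //.
rewrite -big_cat_nat //=.
case: (ltngtP 2 m) => [m2||<-]; [|by lia|].
  2: by rewrite big_geq // parent2 ncount1 tdistxx muln0.
have [w [[|y] [Em // _ yd]]] := @block_decomp d m ltac:(lia) m2.
have -> : parent d m = w.+1 by rewrite Em parent_block.
have /= := @sum_parent d (fun v => nat_of_bool (tdist d v w.+1 == s.+1)) w y.
by rewrite Em (addnS _ y) => -> //; last lia; rewrite tdistxx /= muln0 addn0 addnC.
Qed.

(** These are the [y - 1] earlier siblings in the block and the grandparent; when the parent is [1],
    vertex [2] replaces the grandparent. *)
Lemma ncount2 (d w y : nat) : 1 < d -> 0 < y <= d ->
  ncount d 2 (d * w + 2 + y) = y.
Proof.
move=> d1 yd; set m := d * w + 2 + y.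
have Em : parent d m = w.+1 by rewrite parent_block.
have wm : w.+1 < m by rewrite -Em parent_lt //; lia.
apply/eqP; rewrite -(eqn_add2r (tdist d 1 m == 1)) ncount_parents //; last by lia.
have /= := @sum_parent d (fun v => nat_of_bool (tdist d v m == 1)) w y.
rewrite -/m => ->; last by lia.
rewrite (@tdist_parentr d w.+1 m) // Em tdistxx /= muln1.
rewrite big1_seq ?muln0 ?addn0 1?addnC // => v.
rewrite mem_index_iota => /andP[_ vw].
by rewrite tdist_parentr ?Em ?eqSS ?tdist_eq0 //; lia.
Qed.

(** * Formulas for the coefficients *)

Lemma wcoef_le1 (d n i : nat) : 1 < d -> n < 2 -> wcoef d n i = 0.
Proof.
move=> d1; rewrite wcoefE //; case: n => [|[|//]] _; first by rewrite big_geq.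
by rewrite big_nat1 ncount1.
Qed.

Lemma wcoefS (d n i : nat) : 1 < d ->
  wcoef d n.+1 i = wcoef d n i + ncount d i n.+1.
Proof. by move=> d1; rewrite !wcoefE // big_nat_recr. Qed.

Lemma wcoef0 (d n : nat) : 1 < d -> wcoef d n 0 = 0.
Proof.
move=> d1; rewrite wcoefE // big1_seq // => m _.
rewrite /ncount big1_seq // => u; rewrite mem_index_iota => /andP[_ um].
by rewrite tdist_eq0 //; lia.
Qed.

Lemma wcoef1 (d n : nat) : 1 < d -> wcoef d n 1 = n.-1.
Proof.
move=> d1; elim: n => [|[|n] IH]; first by rewrite wcoef_le1.
  by rewrite wcoef_le1.
by rewrite wcoefS // IH ncount_adj //= addn1.
Qed.

(** Each block adds [1 + 2 + ...] up to its length; doubling avoids division. *)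
Lemma wcoef2 (d w y : nat) : 1 < d -> y <= d ->
  2 * wcoef d (d * w + 2 + y) 2 = w * d * d.+1 + y * y.+1.
Proof.
move=> d1; elim: w y => [|w IHw] y; elim: y => [|y IHy] yd.
- rewrite muln0 !wcoefS // wcoef_le1 // ncount1 /ncount big_nat1 tdist_parentr //.
  by rewrite parent2 tdistxx.
- by rewrite addnS wcoefS // mulnDr IHy ?(ltnW yd) // -addnS ncount2 ?yd //; lia.
- have -> : d * w.+1 + 2 + 0 = d * w + 2 + d by lia.
  by rewrite IHw //; lia.
- by rewrite addnS wcoefS // mulnDr IHy ?(ltnW yd) // -addnS ncount2 ?yd //; lia.
Qed.

(* The number of pairs at distance [i + 2] is, up to the factor [d ^ 2], the
   piecewise linear interpolation of the number of pairs at distance [i] along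
   the affine map [w |-> d * w + 2] sending a vertex to its last child. *)
Lemma wcoef_interp (d i w y : nat) : 1 < d -> y <= d ->
  wcoef d (d * w + 2 + y) i.+3 =
  d * ((d - y) * wcoef d w i.+1 + y * wcoef d w.+1 i.+1).
Proof.
move=> d1 yd; rewrite wcoefS // !wcoefE // big_ltn ?ncount1; last by lia.
under eq_big_nat => m /andP[m2 _] do rewrite ncount_parent //.
rewrite -big_distrr /= sum_parent // ncount1; congr (d * _).
by rewrite mulnDr addnA -mulnDl subnK.
Qed.

Lemma wcoef_le2 (d n i : nat) : 1 < d -> n <= 2 -> wcoef d n i.+3 = 0.
Proof.
move=> d1; rewrite leq_eqVlt => /orP[/eqP->|n2]; last exact: wcoef_le1.
have := wcoef_interp i 0 d1 (leq0n d); rewrite muln0 => ->.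
by rewrite wcoef_le1 // !muln0.
Qed.

(** * Recurrences for the thresholds *)

Lemma geom_quotientS (d k : nat) : 1 < d ->
  (d ^ k.+1 - 1) %/ (d - 1) = d * ((d ^ k - 1) %/ (d - 1)) + 1.
Proof.
move=> d1; rewrite !subn1 !predn_exp !mulKn; try lia.
rewrite big_ord_recl /= expn0 addnC big_distrr /=.
by congr (_ + _); apply: eq_bigr => i _; rewrite expnS.
Qed.

Lemma n_k0 (d : nat) : n_k d 0 = 2.
Proof. by rewrite /n_k expn0 div0n muln0. Qed.

Lemma n_kS (d k : nat) : 1 < d -> n_k d k.+1 = d * (n_k d k).-1 + 3.
Proof.
move=> d1; rewrite /n_k geom_quotientS //.
by move: (_ %/ _) => S; rewrite addSn /=; lia.
Qed.

Lemma p_k0 (d : nat) : p_k d 0 = 4.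
Proof. by rewrite /p_k /m_k expn0 div0n muln0. Qed.

Lemma p_kS (d k : nat) : 1 < d -> p_k d k.+1 = d * p_k d k + 2.
Proof.
move=> d1; rewrite /p_k /m_k geom_quotientS // expnS.
by move: (_ %/ _) => S; rewrite !addSn !subn1 /=; lia.
Qed.

Lemma p_k_gt0 (d k : nat) : 1 < d -> 0 < p_k d k.
Proof. by move=> d1; case: k => [|k]; rewrite ?p_k0 ?p_kS ?addn2. Qed.

Lemma n_k_ltS (d k : nat) : 1 < d -> n_k d k < n_k d k.+1.
Proof. by move=> d1; rewrite n_kS //; nia. Qed.

Lemma p_k_leS (d k : nat) : 1 < d -> p_k d k <= p_k d k.+1.
Proof. by move=> d1; rewrite p_kS //; nia. Qed.

Lemma p_k_lt_n_kS (d k : nat) : 1 < d -> p_k d k < n_k d k.+1.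
Proof.
move=> d1; elim: k => [|k IH]; first by rewrite p_k0 n_kS // n_k0; lia.
by rewrite p_kS // n_kS //; nia.
Qed.

(** * Comparison of consecutive coefficients *)

Lemma wcoef_interp_ge (d a i j : nat) : 1 < d -> 0 < a ->
  (forall n, a <= n -> wcoef d n i.+1 <= wcoef d n j.+1) ->
  forall n, d * a + 2 <= n -> wcoef d n i.+3 <= wcoef d n j.+3.
Proof.
move=> d1 a0 H n an.
have [w [y [En y0 yd]]] := @block_decomp d n ltac:(lia) ltac:(nia).
rewrite En !wcoef_interp // leq_mul2l; apply/orP; right.
have wa : a <= w.+1 by nia.
apply: leq_add; rewrite leq_mul2l; apply/orP; last by right; apply: H.
case: (leqP a w) => [aw|wa']; first by right; apply: H.
(* Here [w = a - 1] and [y = d], so the weight [d - y] vanishes. *)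
by left; nia.
Qed.

Lemma wcoef_interp_le (d a i j : nat) : 1 < d ->
  (forall n, n <= a -> wcoef d n i.+1 <= wcoef d n j.+1) ->
  forall n, n <= d * a + 2 -> wcoef d n i.+3 <= wcoef d n j.+3.
Proof.
move=> d1 H n na.
case: (leqP n 2) => [n2|n2]; first by rewrite !wcoef_le2.
have [w [y [En y0 yd]]] := @block_decomp d n ltac:(lia) n2.
have wa : w < a by nia.
rewrite En !wcoef_interp // leq_mul2l; apply/orP; right.
by apply: leq_add; rewrite leq_mul2l; apply/orP; right; apply: H; lia.
Qed.

Lemma wcoef_odd_le_even (d k n : nat) : 1 < d -> p_k d k <= n ->
  wcoef d n (2 * k).+1 <= wcoef d n (2 * k).+2.
Proof.
move=> d1; elim: k n => [|k IH] n.
  rewrite p_k0 muln0 wcoef1 // => n4.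
  have [w [y [En y0 yd]]] := @block_decomp d n ltac:(lia) ltac:(lia).
  rewrite -(leq_pmul2l (isT : 0 < 2)) En wcoef2 //.
  case: w En => [|w] En; nia.
by rewrite p_kS // mulnS; apply: wcoef_interp_ge => //; apply: p_k_gt0.
Qed.

(** For [k = 0], [n - 1] is compared with the triangular number of [n - 2]; they meet at [n = 4]. *)
Lemma wcoef_even_le_odd_top (d k n : nat) : 1 < d -> n <= p_k d k ->
  wcoef d n (2 * k).+2 <= wcoef d n (2 * k).+1.
Proof.
move=> d1; elim: k n => [|k IH] n; last first.
  by rewrite p_kS // mulnS; apply: wcoef_interp_le.
rewrite p_k0 muln0 wcoef1 // => n4.
case: (leqP n 1) => [n1|n1]; first by rewrite wcoef_le1.
rewrite -(leq_pmul2l (isT : 0 < 2)).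
have -> : n = d * 0 + 2 + (n - 2) by lia.
by rewrite wcoef2 //; nia.
Qed.

Lemma wcoef_even_le_odd (d k n : nat) : 1 < d -> p_k d k <= n ->
  wcoef d n (2 * k) <= wcoef d n (2 * k).+1.
Proof.
move=> d1; case: k => [|k]; first by rewrite wcoef0.
elim: k n => [|k IH] n; last first.
  rewrite p_kS // (_ : 2 * k.+2 = (2 * k).+1.+3); last by lia.
  apply: wcoef_interp_ge; rewrite ?p_k_gt0 // => n'.
  by rewrite (_ : (2 * k).+2 = 2 * k.+1); [exact: IH | lia].
rewrite p_kS // p_k0 muln1 => n4.
have [w [y [En y0 yd]]] := @block_decomp d n ltac:(lia) ltac:(lia).
rewrite -(leq_pmul2l (isT : 0 < 2)) En wcoef2 // wcoef_interp // !wcoef1 //=.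
(* The bound on [n] is [4 * d + 2], attained at [w = 3], [y = d]. *)
have : 4 <= w \/ w = 3 /\ y = d by nia.
case=> [w4|[-> ->]]; last by nia.
have -> : (d - y) * w.-1 + y * w = d * w.-1 + y by nia.
(* Equivalent to [2 * d <= w * (d - 1)], true for [w >= 4] and [d >= 2]. *)
have : w * d.+1 <= 2 * d * w.-1 by nia.
nia.
Qed.

(** A diameter bound: both interpolation nodes lie below the previous threshold. *)
Lemma wcoef_eq0 (d k n i : nat) : 1 < d -> n < n_k d k ->
  wcoef d n (2 * k + i).+1 = 0.
Proof.
move=> d1; elim: k n => [|k IH] n; first by rewrite n_k0; apply: wcoef_le1.
rewrite n_kS // => nk; apply/eqP; rewrite -leqn0.
case: (leqP n 2) => [n2|n2]; first by rewrite mulnS wcoef_le2.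
have [w [y [En y0 yd]]] := @block_decomp d n ltac:(lia) n2.
have wa : w < (n_k d k).-1 by nia.
by rewrite En mulnS wcoef_interp // !IH; lia.
Qed.

Lemma p_k_homo (d : nat) : 1 < d -> {homo p_k d : j k / j <= k}.
Proof.
move=> d1; apply: homo_leq => [//|? ? ?|k]; [exact: leq_trans|exact: p_k_leS].
Qed.

Lemma n_k_homo (d : nat) : 1 < d -> {homo n_k d : j k / j <= k}.
Proof.
move=> d1; apply: homo_leq => [//|? ? ?|k]; [exact: leq_trans|].
exact/ltnW/n_k_ltS.
Qed.

(** The steps from [2 * j] to [2 * j + 1] and on to [2 * j + 2] share the threshold [p_k d j]. *)
Lemma wcoef_incr (d k n : nat) : 1 < d -> (forall j, j < k -> p_k d j <= n) ->
  forall m, m < 2 * k -> wcoef d n m <= wcoef d n m.+1.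
Proof.
move=> d1 H m mk; have pm : p_k d m./2 <= n by apply: H; lia.
move: (m./2) pm (odd_double_half m) => j pm <-; rewrite -mul2n.
by case: (odd m); [exact: wcoef_odd_le_even | exact: wcoef_even_le_odd].
Qed.

(** * Location of the peak *)

Definition is_peak (a : nat -> nat) (j : nat) : Prop :=
  (forall m, m < j -> a m <= a m.+1) /\ (forall m, j <= m -> a m.+1 <= a m).

Lemma peak_max (a : nat -> nat) (j : nat) : is_peak a j -> is_max_coef a j.
Proof.
case=> incr decr m; case: (leqP m j) => [mj|/ltnW jm].
  have : forall i, i <= j -> a (j - i) <= a j.
    elim=> [|i IH] ij; first by rewrite subn0.
    apply: leq_trans (IH (ltnW ij)).
    have -> : j - i = (j - i.+1).+1 by lia.
    by apply: incr; lia.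
  by move/(_ (j - m)); rewrite subKn // leq_subr; apply.
rewrite -(subnKC jm); elim: (m - j) => [|i IH]; first by rewrite addn0.
by rewrite addnS (leq_trans _ IH) // decr // leq_addr.
Qed.

Lemma wcoef_peak_low (d k n : nat) : 1 < d -> n_k d k <= n < p_k d k ->
  is_peak (wcoef d n) (2 * k) \/ is_peak (wcoef d n) (2 * k).+1.
Proof.
move=> d1 /andP[nk pk].
have incr : forall m, m < 2 * k -> wcoef d n m <= wcoef d n m.+1.
  apply: wcoef_incr => // j jk; apply: leq_trans nk; apply/ltnW.
  exact: leq_trans (p_k_lt_n_kS j d1) (n_k_homo d1 jk).
have decr : forall m, 2 * k < m -> wcoef d n m.+1 <= wcoef d n m.
  move=> m; rewrite leq_eqVlt => /orP[/eqP<-|km].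
    exact/wcoef_even_le_odd_top/ltnW.
  have -> : m.+1 = (2 * k.+1 + (m - 2 * k.+1)).+1 by lia.
  by rewrite wcoef_eq0 // (ltn_trans pk) // p_k_lt_n_kS.
(* Only this comparison is left open by the thresholds; it selects the peak. *)
case: (leqP (wcoef d n (2 * k)) (wcoef d n (2 * k).+1)) => [le|/ltnW le].
  right; split=> // m; rewrite ltnS leq_eqVlt => /orP[/eqP->//|]; exact: incr.
left; split=> // m; rewrite leq_eqVlt => /orP[/eqP<-//|]; exact: decr.
Qed.

Lemma wcoef_peak_high (d k n : nat) : 1 < d -> p_k d k <= n < n_k d k.+1 ->
  is_peak (wcoef d n) (2 * k + 2).
Proof.
move=> d1 /andP[pk nk]; rewrite (_ : 2 * k + 2 = 2 * k.+1); last by lia.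
split=> [|m km].
  by apply: wcoef_incr => // j jk; apply: leq_trans pk; apply: p_k_homo.
have -> : m.+1 = (2 * k.+1 + (m - 2 * k.+1)).+1 by lia.
by rewrite wcoef_eq0.
Qed.

Lemma n_k_bracket (d n : nat) : 1 < d -> 1 < n ->
  exists k, n_k d k <= n < n_k d k.+1.
Proof.
move=> d1; elim: n => // n IH; rewrite ltnS leq_eqVlt.
case/orP=> [/eqP<-|/IH[k /andP[kn nk]]].
  by exists 0; rewrite n_kS // n_k0; lia.
case: (ltngtP n.+1 (n_k d k.+1)) => [lt|gt|eq]; last 1 first.
- by exists k.+1; rewrite eq leqnn n_k_ltS.
- by exists k; rewrite lt ltnW.
- by lia.
Qed.

Theorem theorem3p3 (d n : nat) (hd : 2 <= d) (hn : 2 <= n) :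
  unimodal (wcoef d n) /\
  (forall k : nat, n_k d k <= n < p_k d k ->
     is_max_coef (wcoef d n) (2 * k) \/ is_max_coef (wcoef d n) (2 * k + 1)) /\
  (forall k : nat, p_k d k <= n < n_k d k.+1 ->
     is_max_coef (wcoef d n) (2 * k + 2) /\
     (forall m, m < 2 * k + 2 -> wcoef d n m <= wcoef d n m.+1)).
Proof.
split; [|split=> k hk].
- have [k /andP[kn nk]] := n_k_bracket hd hn.
  case: (ltnP n (p_k d k)) => [np|pn].
    by have [] := @wcoef_peak_low d k n hd; rewrite ?kn // => pk; eexists; exact: pk.
  by exists (2 * k + 2); apply: wcoef_peak_high; rewrite // pn.
- by rewrite addn1; case: (wcoef_peak_low hd hk) => /peak_max; [left|right].
- have pk := wcoef_peak_high hd hk.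
  by split; [exact: peak_max | case: pk].
Qed.
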